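(* Let $m\ge 1$, let $T$ be the $m$-adic rooted tree, and let $G\le\mathrm{Aut}~T$ be a super strongly fractal profinite group (i.e. a closed subgroup of $\mathrm{Aut}~T$ which is super strongly fractal), with Haar probability measure $\mu_G$. Then a Haar-random element of $G$ is hypercyclic in $G$ with probability $1$; that is, for $\mu_G$-almost every $g\in G$ one has $\overline{\{g|_v : v\in T\}}=G$.
   Context: The $m$-adic tree $T$ is identified with the free monoid of finite words over $\{1,\dots,m\}$ (root = empty word, children of $v$ are $vx$, $x\in\{1,\dots,m\}$); the $n$th level is the set of words of length $n$. $\mathrm{Aut}~T$ is the group of root-fixing, adjacency-preserving bijections of the vertices, acting on the right as $v\mapsto v^g$. For $g\in\mathrm{Aut}~T$, $v\in T$, the section $g|_v\in\mathrm{Aut}~T$ is the unique automorphism with $(vu)^g=v^gu^{g|_v}$ for all $u\in T$. $\mathrm{St}(n)$ is the subgroup fixing all vertices of level $n$; $\mathrm{Aut}~T$ is profinite with the congruence topology, for which $\{\mathrm{St}(n)\}_{n\ge1}$ is a neighborhood basis of the identity, and overlines denote closure in this topology. $\mathrm{St}_G(n)=\mathrm{St}(n)\cap G$; $\mathrm{st}(v)$ is the stabilizer of $v$, and $\varphi_v:\mathrm{st}(v)\to\mathrm{Aut}~T$ is $g\mapsto g|_v$. $G$ is self-similar if $g|_v\in G$ for all $g\in G,v\in T$; $G$ is super strongly fractal if it is self-similar and $\varphi_v(\mathrm{St}_G(n))=G$ for every $n\ge1$ and every vertex $v$ at level $n$ (level-transitivity is not assumed). $\mu_G$ is the unique Haar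 probability measure on the Borel $\sigma$-algebra of $G$. An element $g$ of a self-similar closed subgroup $G$ is hypercyclic in $G$ if $\overline{\{g|_v: v\in T\}}=G$. *)

(* Defs.v *)
From HB Require Import structures.
From mathcomp Require Import all_boot all_order all_algebra.
From mathcomp Require Import all_classical all_reals all_analysis.

Set Implicit Arguments.
Unset Strict Implicit.
Unset Printing Implicit Defensive.

Local Open Scope classical_set_scope.

(* Vertices of the m-adic tree: the children of v are the words rcons v x. *)
Notation word m := (seq 'I_m).

Definition adjacent m (u v : word m) : bool :=
  [exists x, v == rcons u x] || [exists x, u == rcons v x].

Record treeAut (m : nat) := TreeAut {
  tree_act :> word m -> word m;
  tree_act_bij : bijective tree_act;
  tree_act_root : tree_act [::] = [::];
  tree_act_adj : {mono tree_act : u v / adjacent u v}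
}.

HB.instance Definition _ m := gen_eqMixin (treeAut m).
HB.instance Definition _ m := gen_choiceMixin (treeAut m).

Section TreeAutTheory.
Local Open Scope group_scope.
Variable m : nat.
Implicit Types (g h : treeAut m) (u v : word m).

Lemma treeAut_ext g h : g =1 h -> g = h.
Proof.
case: g h => [f bf rf af] [f' bf' rf' af'] /= /funext E; subst f'.
by f_equal; exact: Prop_irrelevance.
Qed.

Lemma treeAut_inj g : injective g.
Proof. exact: bij_inj (tree_act_bij g). Qed.

Lemma treeAut_rcons g v x : exists y, g (rcons v x) = rcons (g v) y.
Proof.
elim/last_ind: v x => [|v z IHv] x.
  have := tree_act_adj g [::] (rcons [::] x).
  rewrite {2}/adjacent (_ : [exists y, _ == _]); last first.
    by apply/existsP; exists x.
  rewrite tree_act_root => /orP[/existsP[y /eqP ->]|/existsP[y /eqP]].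
    by exists y.
  by case: (g _).
have := tree_act_adj g (rcons v z) (rcons (rcons v z) x).
rewrite {2}/adjacent (_ : [exists y, _ == _]); last first.
  by apply/existsP; exists x.
move=> /orP[/existsP[y /eqP ->]|/existsP[y /eqP]]; first by exists y.
have [z' ->] := IHv z => /rcons_inj[/treeAut_inj /(congr1 size)].
by rewrite !size_rcons => /eqP; rewrite -addn2 -[X in X == _]addn0 eqn_add2l.
Qed.

Lemma treeAut_size g v : size (g v) = size v.
Proof.
elim/last_ind: v => [|v x IHv]; first by rewrite tree_act_root.
by have [y ->] := treeAut_rcons g v x; rewrite !size_rcons IHv.
Qed.

Lemma treeAut_cat g v u : g (v ++ u) = g v ++ drop (size v) (g (v ++ u)).
Proof.
suff E : take (size v) (g (v ++ u)) = g v.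
  by rewrite -[LHS](cat_take_drop (size v)) E.
elim/last_ind: u => [|u x IHu].
  by rewrite cats0 -(treeAut_size g v) take_size.
rewrite -rcons_cat; have [y ->] := treeAut_rcons g (v ++ u) x.
by rewrite -cats1 takel_cat ?IHu// treeAut_size size_cat leq_addr.
Qed.

Definition treeAut1 : treeAut m :=
  @TreeAut m id (Bijective (fun=> erefl) (fun=> erefl)) erefl
    (fun _ _ => erefl).

Lemma treeAut_mul_adj g h : {mono h \o g : u v / adjacent u v}.
Proof. by move=> u v /=; rewrite !tree_act_adj. Qed.

Lemma treeAut_mul_root g h : (h \o g) [::] = [::].
Proof. by rewrite /= !tree_act_root. Qed.

(* Automorphisms act on the right: v^(gh) = (v^g)^h. *)
Definition treeAut_mul g h : treeAut m :=
  TreeAut (bij_comp (tree_act_bij h) (tree_act_bij g))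
          (treeAut_mul_root g h) (@treeAut_mul_adj g h).

Lemma treeAut_inv_subproof g : {h : treeAut m | cancel g h /\ cancel h g}.
Proof.
apply: cid; have [f gK fK] := tree_act_bij g.
have fb : bijective f by exists g.
have fr : f [::] = [::] by rewrite -{1}(tree_act_root g) gK.
have fa : {mono f : u v / adjacent u v}.
  by move=> u v; rewrite -(tree_act_adj g) !fK.
by exists (TreeAut fb fr fa).
Qed.

Definition treeAut_inv g : treeAut m := sval (treeAut_inv_subproof g).

Lemma treeAutK g : cancel g (treeAut_inv g).
Proof. by rewrite /treeAut_inv; case: treeAut_inv_subproof => h []. Qed.

Lemma treeAutVK g : cancel (treeAut_inv g) g.
Proof. by rewrite /treeAut_inv; case: treeAut_inv_subproof => h []. Qed.

Lemma treeAut_mulA : associative treeAut_mul.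
Proof. by move=> f g h; apply: treeAut_ext => v. Qed.

Lemma treeAut_mul1 : left_id treeAut1 treeAut_mul.
Proof. by move=> g; apply: treeAut_ext => v. Qed.

Lemma treeAut_mulr1 : right_id treeAut1 treeAut_mul.
Proof. by move=> g; apply: treeAut_ext => v. Qed.

Lemma treeAut_mulV : left_inverse treeAut1 treeAut_inv treeAut_mul.
Proof. by move=> g; apply: treeAut_ext => v /=; rewrite treeAutVK. Qed.

Lemma treeAut_mulrV : right_inverse treeAut1 treeAut_inv treeAut_mul.
Proof. by move=> g; apply: treeAut_ext => v /=; rewrite treeAutK. Qed.

HB.instance Definition _ := isGroup.Build (treeAut m)
  treeAut_mulA treeAut_mul1 treeAut_mulr1 treeAut_mulV treeAut_mulrV.

Lemma treeAut_oneE v : (1 : treeAut m) v = v.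
Proof. by []. Qed.

Lemma treeAut_mulE g h v : (g * h) v = h (g v).
Proof. by []. Qed.

Lemma treeAut_actK g : cancel g (g^-1)%g.
Proof. exact: treeAutK. Qed.

Lemma treeAut_actVK g : cancel (g^-1)%g g.
Proof. exact: treeAutVK. Qed.

Definition section_fun g v u : word m := drop (size v) (g (v ++ u)).

Lemma section_funE g v u : g (v ++ u) = g v ++ section_fun g v u.
Proof. exact: treeAut_cat. Qed.

Lemma section_fun_bij g v : bijective (section_fun g v).
Proof.
exists (section_fun g^-1 (g v)) => u; rewrite {1}/section_fun.
  by rewrite -section_funE treeAut_actK treeAut_size drop_size_cat.
rewrite -[X in X ++ _](treeAut_actK g v) -section_funE treeAut_actVK.
by rewrite -(treeAut_size g v) drop_size_cat.
Qed.

Lemma section_fun_root g v : section_fun g v [::] = [::].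
Proof. by rewrite /section_fun cats0 -(treeAut_size g v) drop_size. Qed.

Lemma adjacent_cat v u w : adjacent (v ++ u) (v ++ w) = adjacent u w.
Proof.
by congr orb; apply: eq_existsb => x; rewrite rcons_cat eqseq_cat// eqxx.
Qed.

Lemma section_fun_adj g v : {mono section_fun g v : u w / adjacent u w}.
Proof.
move=> u w; rewrite -(adjacent_cat (g v)) -!section_funE tree_act_adj.
exact: adjacent_cat.
Qed.

(* The section g|_v: see tree_sectionE and tree_section_uniq. *)
Definition tree_section g v : treeAut m :=
  TreeAut (section_fun_bij g v) (section_fun_root g v) (@section_fun_adj g v).

Lemma tree_sectionE g v u : g (v ++ u) = g v ++ tree_section g v u.
Proof. exact: section_funE. Qed.

Lemma tree_section_uniq g v h :
  (forall u, g (v ++ u) = g v ++ h u) -> h = tree_section g v.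
Proof.
move=> E; apply: treeAut_ext => u; have /eqP := E u.
by rewrite tree_sectionE eqseq_cat// => /andP[_ /eqP].
Qed.

Definition level_stab (n : nat) : set (treeAut m) :=
  [set g | forall v, size v = n -> g v = v].

Lemma level_stab_le (k n : nat) : (k <= n)%N -> level_stab n `<=` level_stab k.
Proof.
move=> kn g gn v vk; case: v vk => [_|x v vk]; first exact: tree_act_root.
have /gn : size ((x :: v) ++ nseq (n - k) x) = n.
  by rewrite size_cat vk size_nseq subnKC.
by rewrite tree_sectionE => /eqP; rewrite eqseq_cat ?treeAut_size// => /andP[/eqP].
Qed.

Lemma level_stab_divE (n : nat) g h :
  level_stab n (g^-1 * h) <-> forall v, size v = n -> h v = g v.
Proof.
split=> [E v vn|E v vn].
  by have := E (g v); rewrite treeAut_mulE treeAut_actK treeAut_size; apply.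
by rewrite treeAut_mulE E ?treeAut_size// treeAut_actVK.
Qed.

(* The cosets g St(n), n >= 1, form a neighborhood basis of g. *)
Definition congruence_nbhs g : set_system (treeAut m) :=
  filter_from [set n | (0 < n)%N] (fun n => [set h | level_stab n (g^-1 * h)]).

HB.instance Definition _ := hasNbhs.Build (treeAut m) congruence_nbhs.

Lemma congruence_nbhs_filter g : ProperFilter (nbhs g).
Proof.
apply: filter_from_proper; last first.
  by move=> n _; exists g; apply/level_stab_divE.
apply: filter_from_filter; first by exists 1%N.
move=> i j i0 j0; exists (maxn i j); first by rewrite /= leq_max i0.
by move=> h E; split; apply: level_stab_le E; rewrite ?leq_maxl ?leq_maxr.
Qed.

Lemma congruence_nbhs_singleton g (A : set (treeAut m)) : nbhs g A -> A g.
Proof. by move=> [n _]; apply; apply/level_stab_divE. Qed.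

Lemma congruence_nbhs_nbhs g (A : set (treeAut m)) :
  nbhs g A -> nbhs g (nbhs^~ A).
Proof.
move=> [n n0 nA]; exists n => // h /level_stab_divE gh.
exists n => // k /level_stab_divE hk; apply/nA/level_stab_divE => v vn.
by rewrite hk// gh.
Qed.

HB.instance Definition _ := Nbhs_isNbhsTopological.Build (treeAut m)
  congruence_nbhs_filter congruence_nbhs_singleton congruence_nbhs_nbhs.

End TreeAutTheory.

Record closedSubgroup (m : nat) := ClosedSubgroup {
  csg_set :> set (treeAut m);
  csg1 : csg_set 1%g;
  csgM : forall g h, csg_set g -> csg_set h -> csg_set (g * h)%g;
  csgV : forall g, csg_set g -> csg_set (g^-1)%g;
  csg_closed : closed csg_set
}.

(* The closed subgroup [G] as a type, with the induced group structure and the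
   subspace topology. *)
Definition csg_type (m : nat) (G : closedSubgroup m) : Type := set_type G.

Section ClosedSubgroupType.
Variables (m : nat) (G : closedSubgroup m).

Lemma csg_group_closed : group_closed (mem (csg_set G)).
Proof.
split; first by apply/mem_set; exact: csg1.
move=> g h /set_mem Gg /set_mem Gh; apply/mem_set.
by apply: csgM => //; exact: csgV.
Qed.

HB.instance Definition _ := SubChoice.copy (csg_type G) (set_type G).
HB.instance Definition _ := Topological.copy (csg_type G) (set_type G).
HB.instance Definition _ := SubChoice_isSubGroup.Build (treeAut m) _
  (csg_type G) csg_group_closed.
HB.instance Definition _ := isPointed.Build (csg_type G) 1%g.

End ClosedSubgroupType.

Definition borel (m : nat) (G : closedSubgroup m) :=
  g_sigma_algebraType (@open (csg_type G)).

(* Left invariance characterizes the Haar probability measure; as G is compact,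
   it is then right-invariant too. *)
Definition is_haar (m : nat) (G : closedSubgroup m) (R : realType)
    (mu : probability (borel G) R) : Prop :=
  forall (g : csg_type G) (A : set (borel G)),
    measurable A -> mu [set (g * x)%g | x in A] = mu A.

Definition self_similar (m : nat) (G : set (treeAut m)) : Prop :=
  forall g v, G g -> G (tree_section g v).

(* Elements of St(n) fix every v of level n, so the image below is that of
   St_G(n), a subgroup of st(v), under g |-> g|_v. *)
Definition super_strongly_fractal (m : nat) (G : set (treeAut m)) : Prop :=
  self_similar G /\
  forall (n : nat) (v : word m), (0 < n)%N -> size v = n ->
    [set tree_section g v | g in level_stab n `&` G] = G.

Definition hypercyclic (m : nat) (G : set (treeAut m)) (g : treeAut m) : Prop :=
  closure [set tree_section g v | v in setT] = G.

(* Main.v *)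
Require Import Defs.
From HB Require Import structures.
From mathcomp Require Import all_boot all_order all_algebra.
From mathcomp Require Import all_classical all_reals all_analysis.
From mathcomp Require Import lra.

(** Fix [n > 0] and [h] in [G]; almost every [g] should have a section that
    acts on level [n] as [h] does.  Only sections along one ray are needed,
    at vertices [v] whose levels are positive multiples of [n].  The action of
    [g|_v] on level [n] depends only on the action of [g] on level
    [size v + n], so whether the sections at the earlier vertices of the ray
    hit the target is decided by the coset of [g] modulo [St_G(size v)].

    Left multiplication by [s] in [St_G(size v)] preserves this coset, and
    turns [g|_v] into [s|_v g|_v] since [s] fixes [v].  Super strong
    fractality says that [s|_v] can be any element of [G].  Hence, inside a set
    [A] determined by level [size v], every nonempty set of those [g] for which
    [g|_v] has a prescribed action on level [n] is a translate of the set for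
    the action of [h], so none has a larger Haar measure than the latter
    ([haar_section_hit_le]).  With [N] the finite number of maps of
    level [n], the target action therefore takes at least a proportion [1 / N]
    of [A] ([haar_section_hit_ge]), and along the ray the measure of the set
    that has missed so far tends to [0] ([miss_bound]).

    So each action on each level is almost surely hit; there are countably many
    of them, and hitting all of them means that the sections of [g] meet every
    coset [h St(n)] with [h] in [G], that is, are dense in [G]. *)

Set Implicit Arguments.
Unset Strict Implicit.
Unset Printing Implicit Defensive.

Import Order.TTheory GRing.Theory Num.Theory.
Local Open Scope classical_set_scope.

(** * The action of an automorphism on a level *)

Notation level_map m n := {ffun n.-tuple 'I_m -> n.-tuple 'I_m}.

Section LevelAction.
Local Open Scope group_scope.
Variable m : nat.
Implicit Types (g h s t : treeAut m) (v : word m) (n l : nat).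

Fact level_action_subproof n g (v : n.-tuple 'I_m) : size (g v) == n.
Proof. by rewrite treeAut_size size_tuple. Qed.

(** Two automorphisms have the same action on level [n] exactly when they lie
    in the same coset of [level_stab n]; recording the coset as an element of a
    finite type is what makes the pigeonhole bound below available. *)
Definition level_action n g : level_map m n :=
  [ffun v => Tuple (level_action_subproof g v)].

Lemma level_actionP n g h :
  level_action n g = level_action n h <-> forall v, size v = n -> g v = h v.
Proof.
split=> [/ffunP E v /eqP vn|E].
  by have := E (Tuple vn); rewrite !ffunE => /(congr1 val).
by apply/ffunP => v; rewrite !ffunE; apply/val_inj/E; rewrite size_tuple.
Qed.

Lemma level_action_le n l g h : (n <= l)%N ->
  level_action l g = level_action l h -> level_action n g = level_action n h.
Proof.
move=> nl /level_actionP E; apply/level_actionP => v vn; apply/esym.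
move: v vn; apply/level_stab_divE/(level_stab_le nl).
by apply/level_stab_divE => v vl; rewrite E.
Qed.

Lemma level_action_mull n t g h :
  level_action n (t * g) = level_action n (t * h) <->
  level_action n g = level_action n h.
Proof.
split=> /level_actionP E; apply/level_actionP => v vn; last first.
  by rewrite !treeAut_mulE E// treeAut_size.
have := E (t^-1 v); rewrite !treeAut_mulE treeAut_actVK.
by apply; rewrite treeAut_size.
Qed.

Lemma level_action_stab n s g :
  level_stab n s -> level_action n (s * g) = level_action n g.
Proof. by move=> sn; apply/level_actionP => v vn; rewrite treeAut_mulE sn. Qed.

Lemma tree_section_mul g h v :
  tree_section (g * h) v = tree_section g v * tree_section h (g v).
Proof.
by apply/esym/tree_section_uniq => u; rewrite !treeAut_mulE !tree_sectionE.
Qed.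

Lemma level_action_section n l v g h : (size v + n <= l)%N ->
  level_action l g = level_action l h ->
  level_action n (tree_section g v) = level_action n (tree_section h v).
Proof.
move=> vl /(level_action_le vl)/level_actionP E.
apply/level_actionP => u un.
have /eqP := E (v ++ u) (etrans (size_cat _ _) (congr1 _ un)).
by rewrite !tree_sectionE eqseq_cat ?treeAut_size// => /andP[_ /eqP].
Qed.

End LevelAction.

(** * Sets determined by a level *)

Section Cylinders.
Variables (m : nat) (G : closedSubgroup m).
Implicit Types A : set (borel G).

(** Membership depends only on the coset modulo [level_stab l]: [A] is a union
    of cosets of a normal open subgroup, hence open and invariant under
    translation by that subgroup. *)
Definition level_determined (l : nat) A : Prop :=
  forall g h : csg_type G,
    level_action l (\val g) = level_action l (\val h) -> A g -> A h.

Lemma level_determined_measurable l A : level_determined l A -> measurable A.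
Proof.
move=> Al; apply: sub_sigma_algebra.
(* The subspace topology: the open set of the ambient group tracing [A] on [G]
   is the union of the cosets of [level_stab l] that meet [A]. *)
exists [set h : treeAut m | exists2 g : csg_type G,
          A g & level_action l (\val g) = level_action l h]; last first.
  apply/seteqP; split=> [h [g Ag gh]|h Ah]; last by exists h.
  exact: Al gh Ag.
(* Neighborhoods are indexed by positive levels, whereas [l] may be [0]. *)
rewrite openE => h [g Ag gh].
exists l.+1 => // k /level_stab_divE hk; exists g => //.
rewrite gh; apply: (level_action_le (leqnSn l)).
by apply/level_actionP => v vl; rewrite hk.
Qed.

Lemma level_determined_stab l A (s g : csg_type G) :
  level_determined l A -> level_stab l (\val s) -> A (s * g)%g <-> A g.
Proof.
by move=> Al sl; split; apply: Al; rewrite /= level_action_stab.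
Qed.

Definition section_hit (n : nat) (v : word m)
    (p : level_map m n) : set (borel G) :=
  [set g : csg_type G | level_action n (tree_section (\val g) v) = p].

Lemma section_hit_determined n v (p : level_map m n) :
  level_determined (size v + n) (section_hit v p).
Proof.
move=> g h gh; rewrite /section_hit /= => <-.
exact/esym/(level_action_section (leqnn _) gh).
Qed.

End Cylinders.

(** * Random sections along a ray *)

Section Haar.
Variables (m : nat) (G : closedSubgroup m).
Hypothesis hG : super_strongly_fractal G.
Variables (R : realType) (mu : probability (borel G) R).
Hypothesis hmu : is_haar mu.
Local Open Scope ereal_scope.

Lemma haar_translate (s : csg_type G) (A B : set (borel G)) : measurable A ->
  (forall g : csg_type G, B (s * g)%g <-> A g) -> mu A = mu B.
Proof.
move=> mA AB; rewrite -(hmu s mA); congr (mu _).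
apply/seteqP; split=> [_ [g Ag <-]|g Bg]; first exact/AB.
exists (s^-1 * g)%g; last by rewrite mulVKg.
by apply/AB; rewrite mulVKg.
Qed.

Variables (n : nat) (h : csg_type G).
Let p := level_action n (\val h).

(** The action [p] is realized by [h] in [G], whereas [q] is arbitrary: if some
    [g] in [A] has [g|_v] acting by [q], translation by an [s] fixing level [l]
    with [s|_v = h (g|_v)^-1] carries the set on the left onto the one on the
    right, and otherwise the set on the left is empty. *)
Lemma haar_section_hit_le (l : nat) (v : word m) (q : level_map m n)
    (A : set (borel G)) :
  (0 < l)%N -> size v = l -> level_determined l A ->
  mu (A `&` section_hit v q) <= mu (A `&` section_hit v p).
Proof.
move=> l0 vl Al.
have [->|/set0P[g [Ag gq]]] := eqVneq (A `&` section_hit v q) set0.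
  by rewrite measure0.
have Gg : csg_set G (\val (g : csg_type G)) by apply: set_valP.
have Gh : csg_set G (\val h) by apply: set_valP.
set h' := tree_section (\val (g : csg_type G)) v in gq *.
have Gh' : csg_set G h' by apply: hG.1.
have : csg_set G (\val h * h'^-1)%g by apply: csgM => //; exact: csgV.
rewrite -[X in X _ -> _](hG.2 l v l0 vl) => -[s [sl Gs] st].
pose s' : csg_type G := exist _ s (mem_set Gs).
suff -> : mu (A `&` section_hit v q) = mu (A `&` section_hit v p) by [].
apply: (@haar_translate s').
  apply: measurableI; first exact: level_determined_measurable Al.
  apply: level_determined_measurable.
  exact: section_hit_determined.
move=> x; suff hitx : section_hit v p (s' * x)%g <-> section_hit v q x.
  by have Ax := @level_determined_stab _ _ _ _ s' x Al sl;
    split=> -[/Ax ? /hitx].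
rewrite /section_hit /= -(gq : _ = q) tree_section_mul sl// st.
have -> : p = level_action n ((\val h * h'^-1) * h')%g by rewrite mulgVK.
exact: level_action_mull.
Qed.

(** Pigeonhole: the actions of [g|_v] on level [n] split [A] into finitely many
    pieces, none of larger measure than the one for [p]. *)
Lemma haar_section_hit_ge (l : nat) (v : word m) (A : set (borel G)) :
  (0 < l)%N -> size v = l -> level_determined l A ->
  (fine (mu A) <=
   #|{: level_map m n}|%:R * fine (mu (A `&` section_hit v p)))%R.
Proof.
move=> l0 vl Al.
have mA := level_determined_measurable Al.
have mhit q : measurable (A `&` section_hit (n := n) v q).
  apply: measurableI => //; apply: level_determined_measurable.
  exact: section_hit_determined.
rewrite [in X in (X <= _)%R](_ : A =
  \bigcup_(q in setT) (A `&` section_hit (n := n) v q)); last first.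
  apply/seteqP; split=> [g Ag|g [q _ []]//].
  by exists (level_action n (tree_section (\val (g : csg_type G)) v)).
rewrite measure_fin_bigcup//; [|exact: finite_finset
  |by move=> q r _ _ [g [[_ <-] [_ <-]]]].
rewrite (fsbigE (index_enum _)) ?index_enum_uniq//; last first.
  by move=> q _; rewrite mem_index_enum.
pose c := fine (mu (A `&` section_hit v p)).
rewrite -lee_fin fineK; last first.
  by rewrite sum_fin_num; apply/allP => _ /mapP[q _ ->]; exact: fin_num_measure.
apply: (@le_trans _ _ (\sum_(q : level_map m n) c%:E)).
  rewrite big_mkcond/=; apply: lee_sum => q _; rewrite in_setT fineK.
    exact: haar_section_hit_le Al.
  exact: fin_num_measure.
by rewrite sumEFin sumr_const mulr_natl.
Qed.

Hypothesis hm : (1 <= m)%N.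
Hypothesis n0 : (0 < n)%N.
(* Consecutive vertices are [n] levels apart, so that the action on level [n]
   of one section is settled before the next vertex is examined; starting at
   level [n] rather than [0] matters as fractality concerns positive levels. *)
Let ray k : word m := nseq (k.+1 * n) (Ordinal hm).

Let miss k : set (borel G) :=
  [set g | forall j, (j < k)%N -> ~ section_hit (ray j) p g].

Lemma missS k : miss k.+1 = miss k `\` section_hit (ray k) p.
Proof.
apply/seteqP; split=> [g gk|g [gk gNk] j].
  by split=> [j jk|]; apply: gk => //; exact: ltnW.
by rewrite ltnS leq_eqVlt => /orP[/eqP ->|/gk].
Qed.

Lemma miss_determined k : level_determined (k.+1 * n) (miss k).
Proof.
move=> g g' gg' gk j jk /= hit; apply: (gk j jk).
have le : (size (ray j) + n <= k.+1 * n)%N.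
  by rewrite size_nseq addnC -mulSn leq_mul2r ltnS jk orbT.
exact: section_hit_determined (esym (level_action_le le gg')) hit.
Qed.

Lemma miss_measurable k : measurable (miss k).
Proof. exact: level_determined_measurable (@miss_determined k). Qed.

(** If [a k] is the measure of [miss k] and [N] the number of maps of level [n],
    [haar_section_hit_ge] says [a k <= N * (a k - a k.+1)].  This gives
    geometric decay, but the weaker linear bound follows from
    [(k.+1 + N) * a k.+1 <= k * a k + (a k + N * a k.+1) <= (k + N) * a k] and
    suffices. *)
Lemma miss_bound k :
  ((k + #|{: level_map m n}|)%:R * fine (mu (miss k)) <=
   #|{: level_map m n}|%:R :> R)%R.
Proof.
elim: k => [|k IHk].
  rewrite add0n -[leRHS]mulr1 ler_wpM2l// -lee_fin fineK ?fin_num_measure//.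
    by apply: probability_le1; exact: miss_measurable.
  exact: miss_measurable.
have mk := miss_measurable k; have mk1 := miss_measurable k.+1.
have mhit : measurable (section_hit (ray k) p : set (borel G)).
  apply: level_determined_measurable; exact: section_hit_determined.
have split : (fine (mu (miss k)) = fine (mu (miss k.+1)) +
    fine (mu (miss k `&` section_hit (ray k) p)))%R.
  rewrite (measureDI mu mk mhit) -missS fineD// fin_num_measure//.
  exact: measurableI.
have := @haar_section_hit_ge (k.+1 * n) (ray k) (miss k).
rewrite muln_gt0 n0 size_nseq => /(_ isT erefl (@miss_determined k)).
have : (0 <= fine (mu (miss k.+1)))%R by rewrite fine_ge0.
have : (0 <= fine (mu (miss k `&` section_hit (ray k) p)))%R.
  by rewrite fine_ge0.
move: IHk; rewrite !natrD split -natr1.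
have : (0 <= k%:R :> R)%R by [].
set N := (_ %:R)%R.
nra.
Qed.

Lemma ae_section_hit :
  {ae mu, forall g : csg_type G,
    exists v, level_action n (tree_section (\val g) v) = p}.
Proof.
have mI : measurable (\bigcap_k miss k).
  by apply: bigcap_measurable => // k _; exact: miss_measurable.
exists (\bigcap_k miss k); split=> //; last first.
  by move=> g /= noHit k _ j _ hit; apply: noHit; exists (ray j).
apply/eqP; rewrite eq_le measure_ge0 andbT.
rewrite -[leLHS]fineK ?fin_num_measure// lee_fin leNgt; apply/negP.
set x := fine _ => x0; set N := #|{: level_map m n}|.
(* A [k] with [k * x > N], against [miss_bound]. *)
pose k := (Num.truncn (N%:R / x)).+1.
have xk : (x <= fine (mu (miss k)))%R.
  apply: fine_le; rewrite ?fin_num_measure//; first exact: miss_measurable.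
  by apply: le_measure; rewrite ?inE//; [exact: miss_measurable|move=> g; exact].
have : (N%:R < k%:R * x)%R.
  by rewrite -ltr_pdivrMr// truncnS_gt.
apply/negP; rewrite -leNgt (le_trans _ (miss_bound k))//.
by apply: ler_pM => //; [exact: ltW|rewrite ler_nat leq_addr].
Qed.

End Haar.

(** * Density of the sections *)

Theorem theorem2 (m : nat) (hm : (1 <= m)%N) (G : closedSubgroup m)
    (hG : super_strongly_fractal G)
    (R : realType) (mu : probability (borel G) R) (hmu : is_haar mu) :
  {ae mu, forall g : csg_type G, hypercyclic G (\val g)}.
Proof.
have ae_hit : {ae mu, forall g : csg_type G, forall n (p : level_map m n.+1),
    (exists h : csg_type G, level_action n.+1 (\val h) = p) ->
    exists v, level_action n.+1 (tree_section (\val g) v) = p}.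
  apply: ae_foralln => n; apply: filter_forall => p.
  have [[h <-]|noh] := pselect (exists h : csg_type G,
      level_action n.+1 (\val h) = p); last by apply: nearW => g /noh.
  have aeh := ae_section_hit hG hmu h hm (ltn0Sn n).
  by apply: (@filterS _ _ (ae_filter_ringOfSetsType mu)) aeh.
apply: (@filterS _ _ (ae_filter_ringOfSetsType mu)) ae_hit => g hit.
rewrite /hypercyclic.
apply/seteqP; split=> [x|x Gx B [[//|n] _ nB]].
  move=> clx; apply: (@csg_closed _ G); apply: closure_subset clx.
  by move=> _ [v _ <-]; apply: hG.1; exact: set_valP.
have [|v /level_actionP gv] := hit n (level_action n.+1 x).
  by exists (exist _ x (mem_set Gx)).
exists (tree_section (\val g) v); split; first by exists v.
exact/nB/level_stab_divE.
Qed.
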